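(* There is no orientable no-fold product structure, even or odd, with $|A|,|B|\ge 2$ and $\operatorname{girth}(L_A)\ge 6$, $\operatorname{girth}(L_B)\ge 6$, $\operatorname{girth}(L_1)\ge 6$.
   Context: A product structure of type $(m,n)$ is a triple $\Pi=(A,B,P)$ with $A,B$ finite (disjoint) sets, $|A|=m$, $|B|=n$, and $P$ a partition of $A\times B$ into cells such that if two distinct positions $(a,b),(a',b')$ lie in the same cell then $a\ne a'$ and $b\ne b'$. It is even if every cell has size $2$, and odd if exactly one cell has size $1$ and all others have size $2$. Horizontal graphs: $L_A$ is the simple graph on $A$ in which $\{a,a'\}$ is an edge iff there are $b,b'\in B$ with $\{(a,b),(a',b')\}\in P$; $L_B$ is the simple graph on $B$ in which $\{b,b'\}$ is an edge iff there are $a,a'\in A$ with $\{(a,b),(a',b')\}\in P$. Colors are the classes of the equivalence relation on $E(L_A)\sqcup E(L_B)$ generated by declaring, for each 2-cell $\{(a,b),(a',b')\}$, the edge $\{a,a'\}$ equivalent to the edge $\{b,b'\}$. A coherent orientation $O$ is a choice of one direction for each edge of $L_A$ and $L_B$ such that for every 2-cell $\{(a,b),(a',b')\}$ either $a\to a'$ and $b\to b'$, or $a'\to a$ and $b'\to b$. $(\Pi,O)$ is no-fold if no vertex has two distinct outgoing edges of the same color or two distinct incoming edges of the same color. An orientable no-fold product structure is one admitting a coherent orientation $O$ with $(\Pi,O)$ no-fold, considered together with any one such fixed $O$. Each color $c$ has two signed colors $(c,\mathrm{out}),(c,\mathrm{in})$. The middle link $L_1$ is the simple bipartite graph with parts $A\sqcup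 B$ and the set of signed colors, where $v$ is adjacent to $(c,\mathrm{out})$ iff $v$ is the tail of some edge of color $c$, and to $(c,\mathrm{in})$ iff $v$ is the head of some edge of color $c$. Girth is the length of a shortest cycle, $\infty$ for acyclic graphs. *)

(* Defs.v *)
(* MathComp world. *)
From mathcomp Require Import all_boot.

Set Implicit Arguments.
Unset Strict Implicit.
Unset Printing Implicit Defensive.

(** * Girth of a finite simple graph *)

Section Girth.
Variables (T : finType) (e : rel T).

(* [e] is meant to be symmetric and irreflexive; the bound [2 < n] excludes the
   closed walk [:: x; y] that runs back and forth along a single edge. *)
Definition has_cycle (n : nat) : bool :=
  (2 < n) && [exists s : n.-tuple T, ucycleb e s].

(* [None] stands for an infinite girth.  A simple cycle has at most #|T|
   vertices, so that the search range is exhaustive (see [girth_geP]). *)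
Definition girth : option nat :=
  let g := find has_cycle (iota 0 #|T|.+1) in
  if g <= #|T| then Some g else None.

Definition girth_ge (k : nat) : bool :=
  if girth is Some g then k <= g else true.

Lemma girth_geP (k : nat) :
  reflect (forall s : seq T, ucycle e s -> 2 < size s -> k <= size s)
          (girth_ge k).
Proof.
have cycP (s : seq T) : ucycle e s -> 2 < size s ->
    has_cycle (size s) && (size s <= #|T|).
  move=> ucs s2; rewrite /has_cycle s2 /=; apply/andP; split.
    by apply/existsP; exists (in_tuple s).
  by rewrite -(card_uniqP (proj2 (andP ucs))) max_card.
rewrite /girth_ge /girth; set g := find _ _.
have before (n : nat) : n < g -> n <= #|T| -> ~~ has_cycle n.
  move=> lt_ng le_nT; have := before_find 0 lt_ng.
  by rewrite nth_iota ?ltnS // add0n => ->.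
have [le_gT|lt_Tg] := leqP g #|T|.
  apply: (iffP idP) => [le_kg s ucs s2|cyc].
    have /andP[cs le_sT] := cycP s ucs s2.
    apply: leq_trans le_kg _; rewrite leqNgt; apply/negP => lt_sg.
    by move: (before _ lt_sg le_sT); rewrite cs.
  have : has has_cycle (iota 0 #|T|.+1) by rewrite has_find size_iota ltnS.
  move/(nth_find 0); rewrite -/g nth_iota ?ltnS // add0n.
  case/andP => g2 /existsP[s ucs].
  by rewrite -(size_tuple s); apply: cyc; rewrite ?size_tuple.
apply: ReflectT => s ucs s2; have /andP[cs le_sT] := cycP s ucs s2.
by move: (before _ (leq_ltn_trans le_sT lt_Tg) le_sT); rewrite cs.
Qed.

End Girth.

(** * Product structures *)

Section ProductStructures.
Variables A B : finType.

Variable P : {set {set A * B}}.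

Definition product_structure : Prop :=
  partition P [set: A * B] /\
  (forall (C : {set A * B}) (p q : A * B),
     C \in P -> p \in C -> q \in C -> p != q -> p.1 != q.1 /\ p.2 != q.2).

Definition even_structure : Prop := forall C, C \in P -> #|C| = 2.

Definition odd_structure : Prop :=
  exists C, [/\ C \in P, #|C| = 1 & forall D, D \in P -> D != C -> #|D| = 2].

Definition two_cell (p q : A * B) : bool := (p != q) && ([set p; q] \in P).

(* The condition [a != a'] matters: a 1-cell {(a, b)} must not yield a loop. *)
Definition LA : rel A := fun a a' =>
  (a != a') && [exists b, exists b', [set (a, b); (a', b')] \in P].

Definition LB : rel B := fun b b' =>
  (b != b') && [exists a, exists a', [set (a, b); (a', b')] \in P].

Definition edge : finType := ({set A} + {set B})%type.

Definition edges : {set edge} :=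
  [set x : edge | match x with
   | inl X => [exists a, exists a', LA a a' && (X == [set a; a'])]
   | inr Y => [exists b, exists b', LB b b' && (Y == [set b; b'])]
   end].

Definition color_step : rel edge := fun x y =>
  [exists p, exists q, [&& two_cell p q,
     x == inl [set p.1; q.1] & y == inr [set p.2; q.2]]].

(* Reflexive, symmetric and transitive closure of [color_step]. *)
Definition same_color : rel edge :=
  connect (fun x y => color_step x y || color_step y x).

Definition color : finType :=
  {c : {set edge} | c \in equivalence_partition same_color edges}.

(* An orientation is given by its arcs: [oA a a'] means a -> a'. *)
Variables (oA : rel A) (oB : rel B).

Definition orientation (T : finType) (e o : rel T) : Prop :=
  (forall x y, o x y -> e x y) /\ (forall x y, e x y -> o x y (+) o y x).

Definition coherent_orientation : Prop :=
  [/\ orientation LA oA, orientation LB oB &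
      forall p q, two_cell p q ->
        (oA p.1 q.1 /\ oB p.2 q.2) \/ (oA q.1 p.1 /\ oB q.2 p.2)].

(* [arc c v w]: there is an edge of color [c] directed from [v] to [w]. *)
Definition arc (c : color) : rel (A + B) := fun v w =>
  match v, w with
  | inl a, inl a' => oA a a' && ((inl [set a; a'] : edge) \in val c)
  | inr b, inr b' => oB b b' && ((inr [set b; b'] : edge) \in val c)
  | _, _ => false
  end.

Definition no_fold : Prop :=
  forall (c : color) (v w w' : A + B),
    (arc c v w -> arc c v w' -> w = w') /\ (arc c w v -> arc c w' v -> w = w').

(* [(c, true)] is (c, out) and [(c, false)] is (c, in). *)
Definition signed_color : finType := (color * bool)%type.

Definition incident (v : A + B) (s : signed_color) : bool :=
  if s.2 then [exists w, arc s.1 v w] else [exists w, arc s.1 w v].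

Definition L1 : rel ((A + B) + signed_color) := fun x y =>
  match x, y with
  | inl v, inr s | inr s, inl v => incident v s
  | _, _ => false
  end.

End ProductStructures.

Arguments L1 {A B} P oA oB.

(* Main.v *)
(* Say that a vertex is on a signed colour if they are adjacent in L_1.  A cell
   {(a, b), (a', b')} puts a and b on a common signed colour and a', b' on the
   opposite one, so for each b (not in the 1-cell) the neighbours b' of b in L_B
   partition A into classes, each contained in one signed colour.  As L_1 has no
   4-cycle, the vertices of A on a signed colour s go to distinct neighbours of
   any b not on s; and at most one vertex of B is on both s and its opposite.
   Hence each class has at most d elements, where r <= d are the two smallest
   degrees in L_B (outside the 1-cell), and |A| <= r d.  A Moore-type count in
   L_B, which has no 3- or 4-cycle, gives |B| > r d.  So |A| < |B|, and
   |B| < |A| by symmetry. *)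
Require Import Defs.
From mathcomp Require Import all_boot.
From mathcomp Require Import zify.

Set Implicit Arguments.
Unset Strict Implicit.
Unset Printing Implicit Defensive.

(** * Walks of length two in graphs of girth at least five *)

Section Graphs.
Variables (T : finType) (e : rel T).

Definition nbhd (x : T) : {set T} := [set y | e x y].

Lemma girth_ge_leq (k l : nat) : k <= l -> girth_ge e l -> girth_ge e k.
Proof.
move=> le_kl /girth_geP girth_l; apply/girth_geP => s cyc_s s_gt2.
exact: leq_trans le_kl (girth_l s cyc_s s_gt2).
Qed.

Lemma girth_ge4_no_triangle (x y z : T) :
  girth_ge e 4 -> uniq [:: x; y; z] -> e x y -> e y z -> e z x -> False.
Proof.
move=> /girth_geP girth4 uniq_xyz exy eyz ezx.
have := girth4 [:: x; y; z]; rewrite /ucycle uniq_xyz /= exy eyz ezx /=.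
by move=> /(_ isT isT).
Qed.

Lemma girth_ge5_no_square (x y z w : T) :
  girth_ge e 5 -> uniq [:: x; y; z; w] ->
  e x y -> e y z -> e z w -> e w x -> False.
Proof.
move=> /girth_geP girth5 uniq_xyzw exy eyz ezw ewx.
have := girth5 [:: x; y; z; w]; rewrite /ucycle uniq_xyzw /= exy eyz ezw ewx /=.
by move=> /(_ isT isT).
Qed.

Hypotheses (e_sym : symmetric e) (e_irr : irreflexive e).

Lemma edge_neq (x y : T) : e x y -> x != y.
Proof. by apply: contraTneq => ->; rewrite e_irr. Qed.

(* A walk v - u - w is sent to w if w != v and to u otherwise; without triangles
   and squares this is an injection into the vertices different from v. *)
Lemma sum_degree_nbhd_lt (v : T) :
  girth_ge e 5 -> \sum_(u in nbhd v) #|nbhd u| < #|T|.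
Proof.
move=> girth5; have girth4 : girth_ge e 4 by apply: girth_ge_leq girth5.
pose W := [set p : T * T | e v p.1 && e p.1 p.2].
pose f (p : T * T) := if p.2 == v then p.1 else p.2.
have -> : \sum_(u in nbhd v) #|nbhd u| = #|W|.
  under eq_bigr do rewrite -sum1_card.
  rewrite pair_big_dep sum1dep_card.
  by apply: eq_card => p; rewrite !inE.
have f_inj : {in W &, injective f}.
  move=> [u w] [u' w']; rewrite !inE /f /= => /andP[vu uw] /andP[vu' uw'].
  case: (eqVneq w v) => [->|w_v]; case: (eqVneq w' v) => [->|w'_v].
  - by move=> ->.
  - move=> eq_uw'; subst w'; exfalso.
    apply: (@girth_ge4_no_triangle v u u') => //; rewrite 1?e_sym //=.
    by rewrite !inE negb_or !edge_neq // e_sym.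
  - move=> eq_wu'; subst u'; exfalso.
    apply: (@girth_ge4_no_triangle v u w) => //; rewrite 1?e_sym //=.
    by rewrite !inE negb_or !edge_neq.
  - move=> eq_ww'; subst w'; case: (eqVneq u u') => [->//|u_u']; exfalso.
    apply: (@girth_ge5_no_square v u w u') => //; rewrite 1?e_sym //=.
    by rewrite !inE !negb_or u_u' !(edge_neq vu, edge_neq vu', edge_neq uw) eq_sym w_v
       eq_sym (edge_neq uw').
have /subset_leq_card : f @: W \subset [set~ v].
  apply/subsetP => _ /imsetP[[u w] + ->]; rewrite !inE /f /= => /andP[vu _].
  by case: (eqVneq w v) => // _; rewrite eq_sym edge_neq.
have : 0 < #|T| by apply/card_gt0P; exists v.
by rewrite cardsC1 (card_in_imset f_inj); lia.
Qed.

(* Count walks of length 2 from a vertex of [D] whose neighbours are all in [D].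
   If neither [x1] nor its neighbours in [D] were such a vertex, [x1] and one of
   these neighbours would form a triangle with the single vertex outside [D]. *)
Lemma mul_degree_lt_card (D : {set T}) (x0 x1 : T) (d : nat) :
  girth_ge e 5 -> #|~: D| <= 1 -> x0 \in D -> x1 \in D -> x1 != x0 ->
  1 < d -> #|nbhd x0| <= d ->
  (forall x, x \in D -> x != x0 -> d <= #|nbhd x|) ->
  #|nbhd x0| * d < #|T|.
Proof.
move=> girth5 /card_le1_eqP D_co x0D x1D x10 d_gt1 deg_x0 deg_D.
have girth4 : girth_ge e 4 by apply: girth_ge_leq girth5.
have [v vD sND] : exists2 v, v \in D & nbhd v \subset D.
  have [?|/subsetPn[w]] := boolP (nbhd x1 \subset D); first by exists x1.
  rewrite inE => x1w wD.
  have /card_gt0P[u] : 0 < #|nbhd x1 :\ w|.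
    have := deg_D _ x1D x10; rewrite (cardsD1 w) inE x1w; lia.
  rewrite !inE => /andP[u_w x1u].
  have uD : u \in D.
    by apply: contraNT u_w => uD; rewrite (D_co u w) ?inE ?uD ?wD.
  exists u => //; apply/subsetP => w'; rewrite inE => uw'.
  apply: contraT => w'D; exfalso.
  have eq_w : w' = w by apply: D_co; rewrite inE.
  subst w'; apply: (@girth_ge4_no_triangle x1 u w) => //; rewrite 1?e_sym //=.
  by rewrite !inE negb_or !edge_neq.
apply: leq_ltn_trans (sum_degree_nbhd_lt v girth5).
have sum_ge (X : {set T}) : X \subset D -> x0 \notin X ->
    #|X| * d <= \sum_(u in X) #|nbhd u|.
  move=> /subsetP sXD x0X; rewrite -sum_nat_const; apply: leq_sum => u uX.
  by apply: deg_D (sXD _ uX) _; apply: contraNneq x0X => <-.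
have [eq_v|v_x0] := eqVneq v x0.
  by rewrite eq_v in sND *; apply: sum_ge => //; rewrite inE e_irr.
have deg_v := deg_D _ vD v_x0.
have [x0v|x0v] := boolP (x0 \in nbhd v); last first.
  by apply: leq_trans (sum_ge _ sND x0v); rewrite leq_mul2r (leq_trans deg_x0) ?orbT.
(* Here [x0] is the only neighbour of [v] that may have degree below [d]. With r the degree of [x0],
   the sum is at least r + (d - 1) d, which is at least r d because r <= d. *)
rewrite (big_setD1 x0) //=.
have := sum_ge (nbhd v :\ x0); rewrite !inE eqxx /=.
move/(_ (subset_trans (subsetDl _ _) sND) isT).
have := cardsD1 x0 (nbhd v); rewrite x0v; nia.
Qed.

End Graphs.

(** * Bounding one factor by degrees in the graph on the other *)

(* The structure is abstracted from [product_structure] so that it applies to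
   both (A, B) and (B, A); [S] stands for the signed colours. *)
Section HalfProduct.
Variables (A B : finType) (cell : rel (A * B)) (e : rel B).
Variables (S : eqType) (bar : S -> S) (onA : A -> S -> bool) (onB : B -> S -> bool).
Variable D : {set B}.

Hypotheses (cell_sym : symmetric cell)
  (cell_inj : forall p q q', cell p q -> cell p q' -> q = q')
  (cell_total : forall a b, b \in D -> exists q, cell (a, b) q)
  (cell_edge : forall p q, cell p q -> e p.2 q.2).
Hypothesis bar_neq : forall s, bar s != s.
Hypothesis signed_color : forall b b', e b b' -> exists s,
  [/\ onB b s, onB b' (bar s) &
      forall a a', cell (a, b) (a', b') -> onA a s && onA a' (bar s)].
Hypotheses
  (no_squareA : forall a a' s s', a != a' -> s != s' ->
     onA a s -> onA a s' -> onA a' s -> onA a' s' -> False)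
  (no_squareB : forall b b' s s', b != b' -> s != s' ->
     onB b s -> onB b s' -> onB b' s -> onB b' s' -> False).
Hypotheses (e_sym : symmetric e) (e_irr : irreflexive e) (e_girth : girth_ge e 5).

(** Send [a] to the second coordinate of the partner of (a, b), a neighbour of [b]. If two elements
    of [X] had the same image, both would be on the signed colour [t] of that edge at [b]; since [b]
    is on [t] but not on [s], this would be a 4-cycle through [s] and [t]. *)
Lemma card_onA_le_degree (s : S) (b : B) (X : {set A}) :
  b \in D -> ~~ onB b s -> {in X, forall a, onA a s} -> #|X| <= #|nbhd e b|.
Proof.
move=> bD b_s X_s; have q_ex a : exists q, cell (a, b) q by apply: cell_total.
pose q a := xchoose (q_ex a).
have qP a : cell (a, b) (q a) by apply: (xchooseP (q_ex a)).
have q_inj : {in X &, injective (fun a => (q a).2)}.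
  move=> a a' aX a'X /= eq_q; apply/eqP; apply: contraT => a_a'; exfalso.
  have [t [bt _ tP]] := signed_color (cell_edge (qP a)).
  have t_s : t != s by apply: contraNneq b_s => <-.
  have /andP[at_ _] : onA a t && onA (q a).1 (bar t).
    by apply: tP; rewrite -surjective_pairing.
  have /andP[a't _] : onA a' t && onA (q a').1 (bar t).
    by apply: tP; rewrite eq_q -surjective_pairing.
  by apply: (no_squareA a_a' t_s); auto.
rewrite -(card_in_imset q_inj); apply: subset_leq_card.
by apply/subsetP => _ /imsetP[a _ ->]; rewrite inE; apply: (cell_edge (qP a)).
Qed.

Definition partners (b b' : B) : {set A} :=
  [set a | [exists a', cell (a, b) (a', b')]].

(** The cells over an edge match the two classes. This lets a class on [s] be bounded through the
    matching class, which is on [bar s]. *)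
Lemma card_partners_sym b b' : #|partners b b'| = #|partners b' b|.
Proof.
suff le_card c c' : #|partners c c'| <= #|partners c' c|.
  by apply/eqP; rewrite eqn_leq !le_card.
have [->|[a0 _]] := set_0Vmem (partners c c'); first by rewrite cards0.
(* On [partners c c'] the search always succeeds, so [a0] is never returned there. *)
pose f a := odflt a0 [pick a' | cell (a, c) (a', c')].
have fP a : a \in partners c c' -> cell (a, c) (f a, c').
  rewrite inE /f => /existsP[a' aa']; case: pickP => //= none.
  by rewrite none in aa'.
have f_inj : {in partners c c' &, injective f}.
  move=> a a' /fP fa /fP fa' eq_f.
  rewrite cell_sym in fa; rewrite cell_sym -eq_f in fa'.
  by case: (cell_inj fa fa').
rewrite -(card_in_imset f_inj); apply: subset_leq_card.
apply/subsetP => _ /imsetP[a /fP fa ->]; rewrite inE.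
by apply/existsP; exists a; rewrite cell_sym.
Qed.

(** If [b1] misses [s] or [bar s], its degree bounds the class directly. Otherwise [b0] misses one
    of them, for lack of a 4-cycle, and its degree is no larger. *)
Lemma card_partners_le (b b' b0 b1 : B) :
  b0 \in D -> b1 \in D -> b1 != b0 -> #|nbhd e b0| <= #|nbhd e b1| ->
  e b b' -> #|partners b b'| <= #|nbhd e b1|.
Proof.
move=> b0D b1D b10 le_deg ebb'; have [s [_ _ sP]] := signed_color ebb'.
have le_s c : c \in D -> ~~ onB c s -> #|partners b b'| <= #|nbhd e c|.
  move=> cD c_s; apply: (card_onA_le_degree cD c_s) => a.
  by rewrite inE => /existsP[a' /sP/andP[]].
have le_bar c : c \in D -> ~~ onB c (bar s) -> #|partners b b'| <= #|nbhd e c|.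
  move=> cD c_s; rewrite card_partners_sym; apply: (card_onA_le_degree cD c_s) => a.
  by rewrite inE => /existsP[a']; rewrite cell_sym => /sP/andP[].
have [b1s|] := boolP (onB b1 s); last exact: le_s.
have [b1s'|] := boolP (onB b1 (bar s)); last exact: le_bar.
apply: leq_trans le_deg.
have [b0s|] := boolP (onB b0 s); last exact: le_s.
have [b0s'|] := boolP (onB b0 (bar s)); last exact: le_bar.
by case: (no_squareB b10 (bar_neq s)).
Qed.

Lemma cardA_lt_cardB : #|~: D| <= 1 -> 1 < #|D| -> 1 < #|A| -> #|A| < #|B|.
Proof.
move=> D_co D_gt1 A_gt1.
have /card_gt0P[x xD] : 0 < #|D| by lia.
case: (@arg_minnP _ x [in D] (fun b => #|nbhd e b|) xD) => b0 /= b0D b0_min.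
have /card_gt0P[y yD] : 0 < #|D :\ b0|.
  by move: D_gt1; rewrite (cardsD1 b0 D) b0D; lia.
case: (@arg_minnP _ y [in D :\ b0] (fun b => #|nbhd e b|) yD) => b1 /=.
rewrite !inE => /andP[b10 b1D] b1_min.
have le_deg : #|nbhd e b0| <= #|nbhd e b1| by apply: b0_min.
have A_le : #|A| <= #|nbhd e b0| * #|nbhd e b1|.
  rewrite -sum_nat_const -cardsT.
  have -> : [set: A] = \bigcup_(b in nbhd e b0) partners b0 b.
    apply/setP => a; rewrite inE; apply/esym/bigcupP.
    have [q aq] := cell_total a b0D.
    exists q.2; first by rewrite inE; apply: (cell_edge aq).
    by rewrite inE; apply/existsP; exists q.1; rewrite -surjective_pairing.
  apply: leq_trans (_ : \sum_(b in nbhd e b0) #|partners b0 b| <= _).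
    elim/big_rec2: _ => [|b n X _ le_n]; first by rewrite cards0.
    by rewrite (leq_trans (leq_card_setU _ _)) // leq_add2l.
  apply: leq_sum => b; rewrite inE; exact: (card_partners_le b0D b1D b10 le_deg).
(* If both minimal degrees are at most 1, then [A_le] contradicts [A_gt1]. *)
have [d_gt1|] := ltnP 1 #|nbhd e b1|; last by nia.
apply: leq_ltn_trans A_le _.
apply: (mul_degree_lt_card e_sym e_irr e_girth D_co b0D b1D) => // b bD b_b0.
by apply: b1_min; rewrite !inE b_b0.
Qed.

End HalfProduct.

(** * Cells, colours and orientations of a product structure *)

Section ProductStructure.
Variables (A B : finType) (P : {set {set A * B}}) (oA : rel A) (oB : rel B).
Hypotheses (P_prod : product_structure P) (o_coh : coherent_orientation P oA oB).
Hypotheses (LA_girth : girth_ge (LA P) 6) (LB_girth : girth_ge (LB P) 6)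
  (L1_girth : girth_ge (L1 P oA oB) 6).

Lemma two_cell_sym : symmetric (two_cell P).
Proof. by move=> p q; rewrite /two_cell eq_sym setUC. Qed.

Lemma two_cell_inj p q q' : two_cell P p q -> two_cell P p q' -> q = q'.
Proof.
case: P_prod => /and3P[_ /trivIsetP P_triv _] _.
move=> /andP[p_q pqP] /andP[p_q' pq'P].
have [/setP/(_ q)|ne_pq] := eqVneq [set p; q] [set p; q'].
  by rewrite !inE eqxx orbT eq_sym (negPf p_q) => /esym/eqP.
have /disjoint_setI0/setP/(_ p) := P_triv _ _ pqP pq'P ne_pq.
by rewrite !inE !eqxx.
Qed.

Lemma two_cell_total p : #|pblock P p| = 2 -> exists q, two_cell P p q.
Proof.
case: P_prod => /and3P[/eqP P_cover _ _] _ card2.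
have pP : p \in cover P by rewrite P_cover inE.
have pblockP := pblock_mem pP; have := pP; rewrite -mem_pblock.
move/eqP/cards2P: card2 => [x [y [x_y eq_b]]]; rewrite eq_b in pblockP *.
rewrite !inE => /orP[]/eqP->; first by exists y; rewrite /two_cell x_y.
by exists x; rewrite two_cell_sym /two_cell x_y.
Qed.

Lemma two_cell_neq p q : two_cell P p q -> p.1 != q.1 /\ p.2 != q.2.
Proof.
case: P_prod => _ P_neq /andP[p_q pqP].
by apply: (P_neq [set p; q]) => //; rewrite !inE eqxx ?orbT.
Qed.

Lemma two_cell_LA p q : two_cell P p q -> LA P p.1 q.1.
Proof.
move=> pq; rewrite /LA (two_cell_neq pq).1 /=.
apply/existsP; exists p.2; apply/existsP; exists q.2.
by rewrite -!surjective_pairing; case/andP: pq.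
Qed.

Lemma two_cell_LB p q : two_cell P p q -> LB P p.2 q.2.
Proof.
move=> pq; rewrite /LB (two_cell_neq pq).2 /=.
apply/existsP; exists p.1; apply/existsP; exists q.1.
by rewrite -!surjective_pairing; case/andP: pq.
Qed.

Lemma LA_sym : symmetric (LA P).
Proof.
suff LA_imp a a' : LA P a a' -> LA P a' a by move=> a a'; apply/idP/idP; apply: LA_imp.
case/andP=> a_a' /existsP[b /existsP[b' cP]]; rewrite /LA eq_sym a_a' /=.
by apply/existsP; exists b'; apply/existsP; exists b; rewrite setUC.
Qed.

Lemma LB_sym : symmetric (LB P).
Proof.
suff LB_imp b b' : LB P b b' -> LB P b' b by move=> b b'; apply/idP/idP; apply: LB_imp.
case/andP=> b_b' /existsP[a /existsP[a' cP]]; rewrite /LB eq_sym b_b' /=.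
by apply/existsP; exists a'; apply/existsP; exists a; rewrite setUC.
Qed.

Lemma LA_irr : irreflexive (LA P).
Proof. by move=> a; rewrite /LA eqxx. Qed.

Lemma LB_irr : irreflexive (LB P).
Proof. by move=> b; rewrite /LB eqxx. Qed.

Lemma inl_edge a a' : LA P a a' -> (inl [set a; a'] : edge A B) \in edges P.
Proof.
move=> aa'; rewrite inE; apply/existsP; exists a; apply/existsP; exists a'.
by rewrite aa' eqxx.
Qed.

Lemma inr_edge b b' : LB P b b' -> (inr [set b; b'] : edge A B) \in edges P.
Proof.
move=> bb'; rewrite inE; apply/existsP; exists b; apply/existsP; exists b'.
by rewrite bb' eqxx.
Qed.

(** The class of [x] itself serves as [c], since the two edges of a cell are one [color_step] apart.
    The two-element list allows [x] to be the edge on either side. *)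
Lemma color_of_edge (x : edge A B) : x \in edges P ->
  exists2 c : color P, x \in val c &
    forall p q, two_cell P p q ->
      x \in [:: inl [set p.1; q.1]; inr [set p.2; q.2]] ->
      (inl [set p.1; q.1] \in val c) && (inr [set p.2; q.2] \in val c).
Proof.
move=> xE; pose X := [set y in edges P | same_color P x y].
have cX : X \in equivalence_partition (same_color P) (edges P) by apply: imset_f.
have memX y : (y \in X) = (y \in edges P) && same_color P x y by rewrite [LHS]inE.
exists (Sub X cX); rewrite SubK; first by rewrite memX xE; apply: connect0.
move=> p q pq x_pq; rewrite !memX.
rewrite (inl_edge (two_cell_LA pq)) (inr_edge (two_cell_LB pq)) /=.
have step : color_step P (inl [set p.1; q.1]) (inr [set p.2; q.2]).
  by apply/existsP; exists p; apply/existsP; exists q; rewrite pq !eqxx.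
move: x_pq; rewrite !inE => /orP[]/eqP->; apply/andP; split;
  by [apply: connect0 | apply: connect1; rewrite step ?orbT].
Qed.

Lemma incident_arc (c : color P) v w : Defs.arc oA oB c v w ->
  incident oA oB v (c, true) && incident oA oB w (c, false).
Proof. by move=> vw; apply/andP; split; apply/existsP; [exists w | exists v]. Qed.

Definition opposite (s : signed_color P) : signed_color P := (s.1, ~~ s.2).

Lemma opposite_neq s : opposite s != s.
Proof. by case: s => c []; rewrite /opposite xpair_eqE eqxx. Qed.

(** The Boolean [s] is both the direction of the edge and the sign of the colour at [a], so the two
    orientations need no separate statements. *)
Lemma incident_oA (c : color P) s a a' : oA a a' = s -> oA a' a = ~~ s ->
  (inl [set a; a'] : edge A B) \in val c ->
  incident oA oB (inl a) (c, s) && incident oA oB (inl a') (c, ~~ s).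
Proof.
case: s => aa' a'a cE; first by apply: incident_arc; rewrite /Defs.arc aa'.
by rewrite andbC; apply: incident_arc; rewrite /Defs.arc a'a setUC.
Qed.

Lemma incident_oB (c : color P) s b b' : oB b b' = s -> oB b' b = ~~ s ->
  (inr [set b; b'] : edge A B) \in val c ->
  incident oA oB (inr b) (c, s) && incident oA oB (inr b') (c, ~~ s).
Proof.
case: s => bb' b'b cE; first by apply: incident_arc; rewrite /Defs.arc bb'.
by rewrite andbC; apply: incident_arc; rewrite /Defs.arc b'b setUC.
Qed.

Lemma oA_swap a a' : LA P a a' -> oA a' a = ~~ oA a a'.
Proof. by case: o_coh => [[_ +] _ _] => /[apply]; case: (oA a a'); case: (oA a' a). Qed.

Lemma oB_swap b b' : LB P b b' -> oB b' b = ~~ oB b b'.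
Proof. by case: o_coh => [_ [_ +] _] => /[apply]; case: (oB b b'); case: (oB b' b). Qed.

Lemma two_cell_orient p q : two_cell P p q -> oA p.1 q.1 = oB p.2 q.2.
Proof.
move=> pq; have := oA_swap (two_cell_LA pq); have := oB_swap (two_cell_LB pq).
by case: o_coh => _ _ /(_ _ _ pq) [] [-> ->] // /esym/negPf-> /esym/negPf->.
Qed.

(** Take the colour of the edge with its direction at [a] as sign. Any cell over the edge has a
    second edge of the same colour, and coherence gives it the same direction. *)
Lemma signed_color_LA a a' : LA P a a' -> exists s,
  [/\ incident oA oB (inl a) s, incident oA oB (inl a') (opposite s) &
      forall b b', two_cell P (a, b) (a', b') ->
        incident oA oB (inr b) s && incident oA oB (inr b') (opposite s)].
Proof.
move=> aa'; have [c ac cP] := color_of_edge (inl_edge aa').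
have /andP[sa sa'] := incident_oA erefl (oA_swap aa') ac.
exists (c, oA a a'); split=> // b b' ab.
rewrite (two_cell_orient ab); apply: incident_oB => //.
  exact: (oB_swap (two_cell_LB ab)).
by have /andP[] := cP _ _ ab (mem_head _ _).
Qed.

Lemma signed_color_LB b b' : LB P b b' -> exists s,
  [/\ incident oA oB (inr b) s, incident oA oB (inr b') (opposite s) &
      forall a a', two_cell P (a, b) (a', b') ->
        incident oA oB (inl a) s && incident oA oB (inl a') (opposite s)].
Proof.
move=> bb'; have [c bc cP] := color_of_edge (inr_edge bb').
have /andP[sb sb'] := incident_oB erefl (oB_swap bb') bc.
exists (c, oB b b'); split=> // a a' ab.
have /= <- := two_cell_orient ab; apply: incident_oA => //.
  exact: (oA_swap (two_cell_LA ab)).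
by have := cP _ _ ab; rewrite !inE eqxx orbT => /(_ isT)/andP[].
Qed.

Lemma incident_no_square v w (s t : signed_color P) : v != w -> s != t ->
  incident oA oB v s -> incident oA oB v t ->
  incident oA oB w s -> incident oA oB w t -> False.
Proof.
move=> v_w s_t vs vt ws wt.
apply: (@girth_ge5_no_square _ (L1 P oA oB) (inl v) (inr s) (inl w) (inr t)) => //.
  exact: girth_ge_leq L1_girth.
by rewrite /= !inE !negb_or /= !(inj_eq inl_inj) !(inj_eq inr_inj) v_w s_t.
Qed.

(** [DA] and [DB] are the vertices away from the 1-cell: everything in the even case, all but one
    vertex on each side in the odd case. The disjunction holds at every position except that of the
    1-cell. *)
Lemma card_lt_absurd (DA : {set A}) (DB : {set B}) :
  (forall a b, (a \in DA) || (b \in DB) -> #|pblock P (a, b)| = 2) ->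
  #|~: DA| <= 1 -> #|~: DB| <= 1 -> 1 < #|DA| -> 1 < #|DB| -> False.
Proof.
move=> P2 DA_co DB_co DA_gt1 DB_gt1.
have A_gt1 : 1 < #|A| by apply: leq_trans DA_gt1 (max_card _).
have B_gt1 : 1 < #|B| by apply: leq_trans DB_gt1 (max_card _).
have: #|A| < #|B|.
  apply: (@cardA_lt_cardB A B (two_cell P) (LB P) (signed_color P) opposite
    (fun a => incident oA oB (inl a)) (fun b => incident oA oB (inr b)) DB) => //.
  - exact: two_cell_sym.
  - exact: two_cell_inj.
  - by move=> a b bD; apply: two_cell_total; apply: P2; rewrite bD orbT.
  - exact: two_cell_LB.
  - exact: opposite_neq.
  - exact: signed_color_LB.
  - by move=> a a' s t a_a'; apply: incident_no_square; rewrite (inj_eq inl_inj).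
  - by move=> b b' s t b_b'; apply: incident_no_square; rewrite (inj_eq inr_inj).
  - exact: LB_sym.
  - exact: LB_irr.
  - exact: girth_ge_leq LB_girth.
suff : #|B| < #|A| by lia.
(* The roles of the factors are exchanged by transporting [two_cell] along [swap]. *)
pose swap (p : B * A) := (p.2, p.1).
apply: (@cardA_lt_cardB B A (fun p q => two_cell P (swap p) (swap q)) (LA P)
    (signed_color P) opposite
    (fun b => incident oA oB (inr b)) (fun a => incident oA oB (inl a)) DA) => //.
- by move=> p q; apply: two_cell_sym.
- by move=> [b a] [b1 a1] [b2 a2] c1 /(two_cell_inj c1) [-> ->].
- move=> b a aD; have [|q aq] := @two_cell_total (a, b); first by apply: P2; rewrite aD.
  by exists (q.2, q.1); rewrite /swap /= -surjective_pairing.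
- by move=> p q /two_cell_LA.
- exact: opposite_neq.
- exact: signed_color_LA.
- by move=> b b' s t b_b'; apply: incident_no_square; rewrite (inj_eq inr_inj).
- by move=> a a' s t a_a'; apply: incident_no_square; rewrite (inj_eq inl_inj).
- exact: LA_sym.
- exact: LA_irr.
- exact: girth_ge_leq LA_girth.
Qed.

(** This serves to raise the bounds on #|A| and #|B| from 2 to 3, so that two vertices remain on
    each side once the 1-cell is avoided. *)
Lemma odd_structure_card : odd_structure P -> odd (#|A| * #|B|).
Proof.
case=> C [CP C1 P2]; case: P_prod => P_part _.
rewrite -card_prod -cardsT (card_partition P_part) (big_setD1 C) //= C1.
rewrite (eq_bigr (fun _ => 2)); last first.
  by move=> E; rewrite !inE => /andP[E_C EP]; apply: P2.
by rewrite sum_nat_const muln2 oddS odd_double.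
Qed.

End ProductStructure.

Theorem theoremB :
  ~ exists (A B : finType) (P : {set {set A * B}}) (oA : rel A) (oB : rel B),
      product_structure P /\
      (even_structure P \/ odd_structure P) /\
      coherent_orientation P oA oB /\
      no_fold P oA oB /\
      2 <= #|A| /\ 2 <= #|B| /\
      girth_ge (LA P) 6 /\
      girth_ge (LB P) 6 /\
      girth_ge (L1 P oA oB) 6.
Proof.
case=> A [B [P [oA [oB [P_prod [parity [o_coh [_ [A2 [B2 [gA [gB g1]]]]]]]]]]]].
have pblockP p : p \in pblock P p /\ pblock P p \in P.
  case: (P_prod) => /and3P[/eqP P_cover _ _] _.
  have pP : p \in cover P by rewrite P_cover inE.
  by rewrite mem_pblock pblock_mem.
have absurd := card_lt_absurd P_prod o_coh gA gB g1.
case: parity => [P2|P_odd].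
  apply: (absurd setT setT); rewrite ?setCT ?cards0 ?cardsT // => a b _.
  exact: P2 (pblockP _).2.
have := odd_structure_card P_prod P_odd; rewrite oddM => /andP[oddA oddB].
have [C [_ /eqP/cards1P[[a0 b0] eq_C] P2]] := P_odd.
apply: (absurd [set~ a0] [set~ b0]); rewrite ?setCK ?cards1 ?cardsC1 //; last first.
- by case: #|B| B2 oddB => [|[|[|n]]].
- by case: #|A| A2 oddA => [|[|[|n]]].
move=> a b; rewrite !inE -negb_and => ab.
apply: P2 (pblockP _).2 _; apply: contraNneq ab => eq_ab.
by have := (pblockP (a, b)).1; rewrite eq_ab eq_C inE xpair_eqE.
Qed.
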